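(* Let $L>0$, $\mu>0$, and let $f:\mathbb{R}^n\to\mathbb{R}$ be $L$-smooth and $\mu$-strongly convex with minimizer $x_*$. Let $x_0\in\mathbb{R}^n$, $R_0>0$ with $R_0\ge\|x_0-x_*\|_2$, and $\varepsilon>0$. Run the Restarted Averaged Heavy-Ball method (R-AHB) from $x_0$ with $\alpha_t=\alpha$, $\beta_t=\beta$, $N_t=N$ for all $t=1,\dots,\tau$, where $$0<\alpha\le\min\left\{\frac{1-\beta}{4L},\ \frac{(1-\beta)^2}{4L\sqrt{3\beta}}\right\},\qquad \beta\in[0,1),\qquad N=\left\lceil\frac{16(1-\beta)}{\alpha\mu}\right\rceil$$ (for $\beta=0$ the second term in the minimum is read as $+\infty$). Then, after $$\tau=\max\left\{\left\lceil\log_2\frac{\mu R_0^2}{\varepsilon}\right\rceil-1,\ 1\right\}$$ iterations (restarts), R-AHB produces a point $\widehat{x}_\tau$ such that $f(\widehat{x}_\tau)-f(x_* )\le\varepsilon$. Furthermore, if $\alpha=\min\left\{\frac{1-\beta}{4L},\frac{(1-\beta)^2}{4L\sqrt{3\beta}}\right\}$, then the total number of AHB iterations equals $$\mathcal{O}\left(\left(\frac L\mu+\frac{L\sqrt\beta}{\mu(1-\beta)}\right)\log\frac{\mu R_0^2}{\varepsilon}\right).$$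
   Context: A differentiable $f:\mathbb{R}^n\to\mathbb{R}$ is $L$-smooth if $\|\nabla f(x)-\nabla f(y)\|_2\le L\|x-y\|_2$ for all $x,y\in\mathbb{R}^n$. It is $\mu$-strongly convex if $f(y)\ge f(x)+\langle\nabla f(x),y-x\rangle+\frac\mu2\|y-x\|_2^2$ for all $x,y\in\mathbb{R}^n$. Averaged Heavy-Ball method (AHB) run for $N$ iterations with stepsize $\alpha>0$, momentum parameter $\beta$ and starting points $x_0,x_1$: for $k=1,\dots,N-1$, $x_{k+1}=x_k-\alpha\nabla f(x_k)+\beta(x_k-x_{k-1})$; the output is $\overline{x}_N=\frac1{N+1}\sum_{i=0}^Nx_i$. Restarted Averaged Heavy-Ball method (R-AHB) with $\tau$ restarts: set $\widehat{x}_0=x_0$; for $t=1,\dots,\tau$, run AHB for $N_t$ iterations with stepsize $\alpha_t$, momentum parameter $\beta_t$ and starting points $\widehat{x}_{t-1}$ and $\widehat{x}_{t-1}-\alpha_t\nabla f(\widehat{x}_{t-1})$, and let $\widehat{x}_t$ be its output. The output of R-AHB is $\widehat{x}_\tau$. The total number of AHB iterations is $N\tau$. *)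

(* Defs.v *)
From mathcomp Require Export all_boot all_order all_algebra.
From mathcomp Require Export all_classical all_reals all_analysis.
Export Order.TTheory GRing.Theory Num.Theory.
Export numFieldNormedType.Exports.

Set Implicit Arguments.
Unset Strict Implicit.
Unset Printing Implicit Defensive.

Local Open Scope ring_scope.

Definition dotr (R : realType) (n : nat) (u v : 'rV[R]_n) : R :=
  \sum_(i < n) u 0 i * v 0 i.

(* The norm `|u| that the library puts on 'rV[R]_n is the sup norm, hence a
   separate Euclidean norm. *)
Definition norm2 (R : realType) (n : nat) (u : 'rV[R]_n) : R :=
  Num.sqrt (\sum_(i < n) u 0 i ^+ 2).

(* Vector of partial derivatives: the gradient wherever f is differentiable. *)
Definition grad (R : realType) (n : nat) (f : 'rV[R]_n -> R) (x : 'rV[R]_n) :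
    'rV[R]_n :=
  \row_(i < n) 'D_(delta_mx 0 i) f x.

Definition smooth (R : realType) (n : nat) (L : R) (f : 'rV[R]_n -> R) : Prop :=
  (forall x, differentiable f x) /\
  (forall x y, norm2 (grad f x - grad f y) <= L * norm2 (x - y)).

Definition strongly_convex (R : realType) (n : nat) (mu : R)
    (f : 'rV[R]_n -> R) : Prop :=
  (forall x, differentiable f x) /\
  (forall x y, f x + dotr (grad f x) (y - x) + mu / 2 * norm2 (y - x) ^+ 2
               <= f y).

Definition minimizer (R : realType) (n : nat) (f : 'rV[R]_n -> R)
    (xs : 'rV[R]_n) : Prop :=
  forall x, f xs <= f x.

Section HeavyBall.
Variables (R : realType) (n : nat) (f : 'rV[R]_n -> R).

(* The k-th iterate of this map from (x_0, x_1) is the pair (x_k, x_(k+1)). *)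
Definition hb_step (alpha beta : R) (p : 'rV[R]_n * 'rV[R]_n) :
    'rV[R]_n * 'rV[R]_n :=
  (p.2, p.2 - alpha *: grad f p.2 + beta *: (p.2 - p.1)).

Definition hb_iterate (alpha beta : R) (x0 x1 : 'rV[R]_n) (k : nat) : 'rV[R]_n :=
  (iter k (hb_step alpha beta) (x0, x1)).1.

Definition ahb (alpha beta : R) (N : nat) (x0 x1 : 'rV[R]_n) : 'rV[R]_n :=
  N.+1%:R^-1 *: \sum_(0 <= i < N.+1) hb_iterate alpha beta x0 x1 i.

(* The parameters of the t-th restart are alpha t, beta t and N t with t >= 1;
   their values at t = 0 are not used. *)
Fixpoint rahb (alpha beta : nat -> R) (N : nat -> nat) (x0 : 'rV[R]_n)
    (t : nat) : 'rV[R]_n :=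
  if t is s.+1 then
    let y := rahb alpha beta N x0 s in
    ahb (alpha t) (beta t) (N t) y (y - alpha t *: grad f y)
  else x0.

End HeavyBall.

(* For beta = 0 the second term of the minimum is read as +oo; it has to be
   dropped explicitly because x / 0 = 0 here. *)
Definition max_stepsize (R : realType) (L beta : R) : R :=
  if beta == 0 then (1 - beta) / (4 * L)
  else Num.min ((1 - beta) / (4 * L))
               ((1 - beta) ^+ 2 / (4 * L * Num.sqrt (3 * beta))).

Definition log2 (R : realType) (x : R) : R := ln x / ln 2.

(* Main.v *)
Require Import Defs.
From mathcomp Require Import ring lra.

(** Write g for the gradient of f. Convexity at y together with the Lipschitz
    bound on g yields the quadratic upper bound
    f y <= f x + <g x, y - x> + L |y - x|^2 ([smooth_upper]). It is a factor 2
    weaker than the descent lemma, but it comes from two gradient inequalities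
    without any integration, and the constants of the theorem leave room for
    the loss. It gives |g x|^2 <= 4 L (f x - f xs) ([sqr_grad_le_gap]), hence
    g xs = 0, and f x - f xs <= L |x - xs|^2 ([gap_le_dist]).

    The first step of each run is a pure gradient step, as if x_(-1) = x_0.
    Hence the extrapolated points
    z_k = x_k + b / (1 - b) (x_k - x_(k-1)) start at z_0 = x_0 and follow
    z_(k+1) = z_k - a / (1 - b) g(x_k). Expanding |z_(k+1) - xs|^2, bounding the
    inner products by convexity and the squared gradient by the gap (where
    a <= (1 - b) / (4 L) is used), one finds that
    |z_(k+1) - xs|^2 + a / (1 - b) sum_(i <= k) (f x_i - f xs)
      + 2 a b / (1 - b)^2 (f x_k - f xs)
    never exceeds |x_0 - xs|^2 + 2 a b / (1 - b)^2 (f x_0 - f xs)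
    ([hb_potential]). The second bound on a makes the last term at most half of
    |x_0 - xs|^2, so Jensen's inequality bounds the gap at the average by
    3 / 2 (1 - b) / (a (N + 1)) |x_0 - xs|^2 ([ahb_gap]).

    With N >= 16 (1 - b) / (a mu) this is at most mu / 4 |x_0 - xs|^2
    ([restart_gap]); by strong convexity one restart then halves the squared
    distance to xs, so that after t restarts the gap is at most
    mu R0^2 / 2^(t + 1) ([rahb_gap]), and tau is chosen to make this <= eps.

    For the iteration count, 1 / a is the larger of the inverses of the two
    bounds on a, hence at most their sum, so N <= 128 A + 1 with
    A = L / mu + L sqrt b / (mu (1 - b)). In positive dimension mu <= L, whence
    A >= 1, which absorbs the rounding of N; likewise ln T >= ln K > 0, with
    T = mu R0^2 / eps, absorbs the lower bound 1 on tau ([tau_le_ln]). *)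

Set Implicit Arguments.
Unset Strict Implicit.
Unset Printing Implicit Defensive.

Local Open Scope ring_scope.

(** * The Euclidean inner product *)

Lemma dotrC (R : realType) n (u v : 'rV[R]_n) : dotr u v = dotr v u.
Proof. by apply: eq_bigr => i _; rewrite mulrC. Qed.

Lemma dotrDl (R : realType) n (u v w : 'rV[R]_n) :
  dotr (u + v) w = dotr u w + dotr v w.
Proof. by rewrite -big_split; apply: eq_bigr => i _; rewrite mxE mulrDl. Qed.

Lemma dotrZl (R : realType) n a (u v : 'rV[R]_n) :
  dotr (a *: u) v = a * dotr u v.
Proof.
by rewrite /dotr mulr_sumr; apply: eq_bigr => i _; rewrite mxE mulrA.
Qed.

Lemma dotrNl (R : realType) n (u v : 'rV[R]_n) : dotr (- u) v = - dotr u v.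
Proof. by rewrite -scaleN1r dotrZl mulN1r. Qed.

Lemma dotrDr (R : realType) n (u v w : 'rV[R]_n) :
  dotr w (u + v) = dotr w u + dotr w v.
Proof. by rewrite dotrC dotrDl !(dotrC w). Qed.

Lemma dotrZr (R : realType) n a (u v : 'rV[R]_n) :
  dotr v (a *: u) = a * dotr v u.
Proof. by rewrite dotrC dotrZl dotrC. Qed.

Lemma dotrNr (R : realType) n (u v : 'rV[R]_n) : dotr v (- u) = - dotr v u.
Proof. by rewrite dotrC dotrNl dotrC. Qed.

Lemma dotr0 (R : realType) n (u : 'rV[R]_n) : dotr u 0 = 0.
Proof. by rewrite -(scale0r u) dotrZr mul0r. Qed.

Lemma dotr_sumr (R : realType) n (u : 'rV[R]_n) N (F : nat -> 'rV[R]_n) :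
  dotr u (\sum_(0 <= i < N) F i) = \sum_(0 <= i < N) dotr u (F i).
Proof. by apply: (big_morph _ (fun v w => dotrDr v w u) (dotr0 u)). Qed.

Definition dotrE := (dotrDl, dotrDr, dotrZl, dotrZr, dotrNl, dotrNr).

Lemma dotr_ge0 (R : realType) n (u : 'rV[R]_n) : 0 <= dotr u u.
Proof. by apply: sumr_ge0 => i _; rewrite -expr2 sqr_ge0. Qed.

Lemma dotr_young (R : realType) n (c : R) (u v : 'rV[R]_n) :
  2 * c * dotr u v <= dotr u u + c ^+ 2 * dotr v v.
Proof. by have := dotr_ge0 (u - c *: v); rewrite !dotrE (dotrC v u); lra. Qed.

Lemma dotr_eq0 (R : realType) n (u : 'rV[R]_n) : dotr u u = 0 -> u = 0.
Proof.
move=> /eqP; rewrite psumr_eq0 => [/allP u0|i _]; last first.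
  by rewrite -expr2 sqr_ge0.
apply/rowP => i; have := u0 i (mem_index_enum i).
by rewrite mxE mulf_eq0 orbb => /eqP.
Qed.

Lemma norm2_sqr (R : realType) n (u : 'rV[R]_n) : norm2 u ^+ 2 = dotr u u.
Proof.
have -> : norm2 u = Num.sqrt (dotr u u).
  by congr Num.sqrt; apply: eq_bigr => i _; rewrite expr2.
by rewrite sqr_sqrtr ?dotr_ge0.
Qed.

(** * First-order inequalities *)

Lemma strongly_convexP (R : realType) n mu (f : 'rV[R]_n -> R) x y :
  strongly_convex mu f ->
  f x + dotr (grad f x) (y - x) + mu / 2 * dotr (y - x) (y - x) <= f y.
Proof. by case=> _ /(_ x y); rewrite norm2_sqr. Qed.

Lemma gradient_ineq (R : realType) n mu (f : 'rV[R]_n -> R) x y :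
  0 < mu -> strongly_convex mu f -> f x + dotr (grad f x) (y - x) <= f y.
Proof.
move=> mu0 fmu; apply: le_trans (strongly_convexP x y fmu).
by rewrite lerDl mulr_ge0 ?dotr_ge0 ?divr_ge0 // ltW.
Qed.

(** Young's inequality with weight L plays the part of Cauchy-Schwarz. *)
Lemma smooth_dotr (R : realType) n L (f : 'rV[R]_n -> R) x y :
  0 < L -> smooth L f ->
  dotr (grad f y - grad f x) (y - x) <= L * dotr (y - x) (y - x).
Proof.
move=> L0 [_ /(_ y x)]; set g := _ - grad f x; set v := y - x => glip.
have gv2 : dotr g g <= L ^+ 2 * dotr v v.
  rewrite -!norm2_sqr -exprMn lerXn2r ?nnegrE ?mulr_ge0 ?sqrtr_ge0 //.
  exact: ltW.
by rewrite -(ler_pM2l L0); have := dotr_young L g v; lra.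
Qed.

(** The gradient inequality at y bounds f y - f x by <grad f y, y - x>, and
    trading grad f y for grad f x costs at most L |y - x|^2. *)
Lemma smooth_upper (R : realType) n L mu (f : 'rV[R]_n -> R) x y :
  0 < L -> 0 < mu -> smooth L f -> strongly_convex mu f ->
  f y <= f x + dotr (grad f x) (y - x) + L * dotr (y - x) (y - x).
Proof.
move=> L0 mu0 fL fmu; have := smooth_dotr x y L0 fL.
have := gradient_ineq y x mu0 fmu.
by rewrite -(opprB y x) dotrNr (dotrDl (grad f y)) (dotrNl (grad f x)); lra.
Qed.

(** A gradient step from x cannot go below the minimum; the step length
    1 / (2 L) minimizes the upper bound of [smooth_upper]. *)
Lemma sqr_grad_le_gap (R : realType) n L mu (f : 'rV[R]_n -> R) xs x :
  0 < L -> 0 < mu -> smooth L f -> strongly_convex mu f -> minimizer f xs ->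
  dotr (grad f x) (grad f x) <= 4 * L * (f x - f xs).
Proof.
move=> L0 mu0 fL fmu fxs; set g := grad f x.
pose t := (2 * L)^-1; have tL : t * L = 2^-1 by rewrite /t; field; lra.
have := smooth_upper x (x - t *: g) L0 mu0 fL fmu.
have := fxs (x - t *: g).
rewrite -/g (addrC x) addrK !dotrE => h1 h2.
have {h1 h2} : t * dotr g g - t * (t * L) * dotr g g <= f x - f xs by lra.
rewrite tL => /(ler_wpM2l (ltW L0)); rewrite mulrBr => h.
have : L * (t * dotr g g) = 2^-1 * dotr g g by rewrite -tL; ring.
have : L * (t * 2^-1 * dotr g g) = 2^-1 * 2^-1 * dotr g g.
  by rewrite -{2}tL; ring.
by lra.
Qed.

Lemma grad_minimizer (R : realType) n L mu (f : 'rV[R]_n -> R) xs :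
  0 < L -> 0 < mu -> smooth L f -> strongly_convex mu f -> minimizer f xs ->
  grad f xs = 0.
Proof.
move=> L0 mu0 fL fmu fxs; apply: dotr_eq0; apply/eqP.
rewrite eq_le dotr_ge0 andbT.
by have := sqr_grad_le_gap xs L0 mu0 fL fmu fxs; rewrite subrr mulr0.
Qed.

Lemma gap_le_dist (R : realType) n L mu (f : 'rV[R]_n -> R) xs x :
  0 < L -> 0 < mu -> smooth L f -> strongly_convex mu f -> minimizer f xs ->
  f x - f xs <= L * dotr (x - xs) (x - xs).
Proof.
move=> L0 mu0 fL fmu fxs.
have gxs0 := grad_minimizer L0 mu0 fL fmu fxs.
have := smooth_upper xs x L0 mu0 fL fmu.
by rewrite gxs0 dotrC dotr0; lra.
Qed.

Lemma dist_le_gap (R : realType) n L mu (f : 'rV[R]_n -> R) xs x :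
  0 < L -> 0 < mu -> smooth L f -> strongly_convex mu f -> minimizer f xs ->
  mu * dotr (x - xs) (x - xs) <= 2 * (f x - f xs).
Proof.
move=> L0 mu0 fL fmu fxs.
have gxs0 := grad_minimizer L0 mu0 fL fmu fxs.
by have := strongly_convexP xs x fmu; rewrite gxs0 dotrC dotr0; lra.
Qed.

(** Jensen's inequality, by summing the gradient inequalities at the mean, where
    the linear terms cancel. *)
Lemma convex_average (R : realType) n mu (f : 'rV[R]_n -> R) N
    (F : nat -> 'rV[R]_n) :
  0 < mu -> strongly_convex mu f ->
  N.+1%:R * f (N.+1%:R^-1 *: \sum_(0 <= i < N.+1) F i)
    <= \sum_(0 <= i < N.+1) f (F i).
Proof.
move=> mu0 fmu; set m := _ *: _; set g := grad f m.
have N0 : N.+1%:R != 0 :> R by rewrite pnatr_eq0.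
have sumF : \sum_(0 <= i < N.+1) F i = N.+1%:R *: m.
  by rewrite scalerA mulfV // scale1r.
have -> : N.+1%:R * f m = \sum_(0 <= i < N.+1) (f m + dotr g (F i - m)).
  rewrite big_split -dotr_sumr big_split /= sumF !big_const_nat !iter_addr_0.
  by rewrite subn0 mulNrn scaler_nat subrr dotr0 addr0 mulr_natl.
by apply: ler_sum => i _; exact: (gradient_ineq _ _ mu0 fmu).
Qed.

(** * One run of the averaged heavy-ball method *)

Definition hb (R : realType) n (f : 'rV[R]_n -> R) a b x0 :=
  hb_iterate f a b x0 (x0 - a *: grad f x0).

(** The point z_(k+1) of the introduction: along this sequence the momentum
    disappears and only gradient steps of length a / (1 - b) remain. *)
Definition hb_extrapolation (R : realType) n (f : 'rV[R]_n -> R) a b x0 k :=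
  hb f a b x0 k.+1 + b / (1 - b) *: (hb f a b x0 k.+1 - hb f a b x0 k).

Lemma hbSS (R : realType) n (f : 'rV[R]_n -> R) a b x0 k :
  hb f a b x0 k.+2 = hb f a b x0 k.+1 - a *: grad f (hb f a b x0 k.+1)
                     + b *: (hb f a b x0 k.+1 - hb f a b x0 k).
Proof. by []. Qed.

Lemma sqr_dist_gradient_step (R : realType) n (c : R) (z g w : 'rV[R]_n) :
  dotr (z - c *: g - w) (z - c *: g - w) =
  dotr (z - w) (z - w) - 2 * c * dotr g (z - w) + c ^+ 2 * dotr g g.
Proof.
rewrite (addrAC z); move: (z - w) => d.
by rewrite !dotrE (dotrC d g); ring.
Qed.

(** The momentum enters through <g(x_(k+1)), x_(k+1) - x_k>, which convexity
    bounds below by f x_(k+1) - f x_k; this telescopes, and accounts for the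
    last summand of the potential. *)
Lemma hb_potential (R : realType) n L mu (f : 'rV[R]_n -> R) xs x0 a b k :
  0 < L -> 0 < mu -> smooth L f -> strongly_convex mu f -> minimizer f xs ->
  0 <= b -> b < 1 -> 0 < a -> a * (4 * L) <= 1 - b ->
  dotr (hb_extrapolation f a b x0 k - xs) (hb_extrapolation f a b x0 k - xs)
    + a / (1 - b) * \sum_(0 <= i < k.+1) (f (hb f a b x0 i) - f xs)
    + 2 * (a / (1 - b)) * (b / (1 - b)) * (f (hb f a b x0 k) - f xs)
  <= dotr (x0 - xs) (x0 - xs)
     + 2 * (a / (1 - b)) * (b / (1 - b)) * (f x0 - f xs).
Proof.
move=> L0 mu0 fL fmu fxs b0 b1 a0 aL.
rewrite /hb_extrapolation; set m := b / (1 - b); set c := a / (1 - b).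
set x := hb f a b x0.
have g0 : 0 < 1 - b by lra.
have m0 : 0 <= m by rewrite divr_ge0 // ltW.
have c0 : 0 < c by rewrite divr_gt0.
(* Division-free relations between the coefficients, which the polynomial
   identities in the coordinates below need. *)
have cE : c = a + m * a by rewrite /c /m; field; lra.
have mE : m = b + m * b by rewrite /m; field; lra.
have cL : c * (4 * L) <= 1 by rewrite /c mulrAC ler_pdivrMr // mul1r.
have grad_term y : c ^+ 2 * dotr (grad f y) (grad f y) <= c * (f y - f xs).
  have h1 := sqr_grad_le_gap y L0 mu0 fL fmu fxs.
  have fy : 0 <= f y - f xs by rewrite subr_ge0.
  rewrite expr2 -mulrA ler_pM2l //.
  apply: (le_trans (ler_wpM2l (ltW c0) h1)).
  by rewrite mulrA ler_piMl.
have convs y : f y - f xs <= dotr (grad f y) (y - xs).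
  by have := gradient_ineq y xs mu0 fmu; rewrite -(opprB y xs) dotrNr; lra.
elim: k => [|k IH] /=.
  have -> : x 1%N + m *: (x 1%N - x 0%N) = x0 - c *: grad f x0.
    rewrite /x /hb /hb_iterate /= cE; apply/rowP => i; rewrite !mxE; ring.
  rewrite sqr_dist_gradient_step big_nat1 /x /=.
  have := grad_term x0; have := ler_wpM2l (ltW c0) (convs x0).
  by rewrite /hb /hb_iterate /=; lra.
set z := x k.+1 + m *: (x k.+1 - x k) in IH.
have -> : x k.+2 + m *: (x k.+2 - x k.+1) = z - c *: grad f (x k.+1).
  rewrite /z {1 2}/x hbSS -/x cE {2}mE.
  by apply/rowP => i; rewrite !mxE; ring.
rewrite sqr_dist_gradient_step big_nat_recr //=.
have -> : dotr (grad f (x k.+1)) (z - xs) = dotr (grad f (x k.+1)) (x k.+1 - xs)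
    + m * dotr (grad f (x k.+1)) (x k.+1 - x k).
  by rewrite /z (addrAC (x k.+1)) (dotrDr (x k.+1 - xs)) dotrZr.
have mom : f (x k.+1) - f (x k) <= dotr (grad f (x k.+1)) (x k.+1 - x k).
  have := gradient_ineq (x k.+1) (x k) mu0 fmu.
  by rewrite -(opprB (x k.+1)) dotrNr; lra.
have := grad_term (x k.+1); have := ler_wpM2l (ltW c0) (convs (x k.+1)).
have := ler_wpM2l (mulr_ge0 (ltW c0) m0) mom.
lra.
Qed.

(** * The step-size bound *)

Lemma max_stepsize_le_gradient (R : realType) (L a b : R) :
  0 < L -> a <= max_stepsize L b -> a * (4 * L) <= 1 - b.
Proof.
move=> L0 h; rewrite -ler_pdivlMr; last by lra.
move: h; rewrite /max_stepsize; case: ifP => // _.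
by rewrite le_min => /andP[].
Qed.

(** As b <= sqrt (3 b), the second bound on the step size implies this
    division-free form, which is trivial at b = 0. *)
Lemma max_stepsize_le_momentum (R : realType) (L a b : R) :
  0 < L -> 0 <= b -> b < 1 -> 0 <= a -> a <= max_stepsize L b ->
  a * b * (4 * L) <= (1 - b) ^+ 2.
Proof.
move=> L0 b0 b1 a0; rewrite /max_stepsize.
have [-> _|bn0] := eqVneq b 0; first by rewrite mulr0 mul0r sqr_ge0.
have {bn0}b0 : 0 < b by rewrite lt_def bn0.
have s0 : 0 < Num.sqrt (3 * b) by rewrite sqrtr_gt0; lra.
have bs : b <= Num.sqrt (3 * b).
  by rewrite -{1}(ger0_norm (ltW b0)) -sqrtr_sqr ler_sqrt; nra.
rewrite le_min => /andP[_]; rewrite ler_pdivlMr; last by nra.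
apply: le_trans; rewrite -!mulrA ler_wpM2l // (mulrC b).
by rewrite !mulrA ler_wpM2l //; lra.
Qed.

Lemma max_stepsize_gt0 (R : realType) (L b : R) :
  0 < L -> 0 <= b -> b < 1 -> 0 < max_stepsize L b.
Proof.
move=> L0 b0 b1; rewrite /max_stepsize.
have p1 : 0 < (1 - b) / (4 * L) by rewrite divr_gt0; lra.
have [//|bn0] := eqVneq b 0.
have {bn0}b0 : 0 < b by rewrite lt_def bn0.
rewrite lt_min p1 divr_gt0 ?exprn_gt0 ?mulr_gt0 ?sqrtr_gt0 //; lra.
Qed.

(** When the first bound on the step size is active the left side is 4 L; when
    the second is, it is 4 sqrt 3 L sqrt b / (1 - b), and sqrt 3 <= 2. *)
Lemma max_stepsize_ge (R : realType) (L b : R) :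
  0 < L -> 0 <= b -> b < 1 ->
  (1 - b) / max_stepsize L b <= 8 * (L + L * Num.sqrt b / (1 - b)).
Proof.
move=> L0 b0 b1; rewrite /max_stepsize.
have q0 : 0 < 1 - b by lra.
have q1 : 0 <= L * Num.sqrt b / (1 - b).
  by rewrite divr_ge0 ?mulr_ge0 ?sqrtr_ge0 //; lra.
have short :
    (1 - b) / ((1 - b) / (4 * L)) <= 8 * (L + L * Num.sqrt b / (1 - b)).
  have -> : (1 - b) / ((1 - b) / (4 * L)) = 4 * L by field; lra.
  by lra.
have [//|bn0] := eqVneq b 0.
have {bn0}b0 : 0 < b by rewrite lt_def bn0.
rewrite /Num.min; case: ifP => // _.
have s0 : 0 < Num.sqrt (3 * b) by rewrite sqrtr_gt0; lra.
have -> : (1 - b) / ((1 - b) ^+ 2 / (4 * L * Num.sqrt (3 * b)))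
    = 4 * (L * Num.sqrt (3 * b) / (1 - b)) by field; lra.
suff : L * Num.sqrt (3 * b) / (1 - b) <= 2 * (L * Num.sqrt b / (1 - b)) by lra.
rewrite mulrA ler_pM2r ?invr_gt0 // mulrCA ler_pM2l //.
have -> : 2 * Num.sqrt b = Num.sqrt (4 * b).
  by rewrite sqrtrM // (_ : 4 = 2 ^+ 2) ?sqrtr_sqr ?ger0_norm //; ring.
by rewrite ler_sqrt; lra.
Qed.

(** * Convergence of the restarted method *)

Lemma ahb_gap (R : realType) n L mu (f : 'rV[R]_n -> R) xs x0 a b N :
  0 < L -> 0 < mu -> smooth L f -> strongly_convex mu f -> minimizer f xs ->
  0 <= b -> b < 1 -> 0 < a -> a <= max_stepsize L b ->
  a * N.+1%:R * (f (ahb f a b N x0 (x0 - a *: grad f x0)) - f xs)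
    <= (1 - b) * (3 / 2 * dotr (x0 - xs) (x0 - xs)).
Proof.
move=> L0 mu0 fL fmu fxs b0 b1 a0 aL.
have aL1 := max_stepsize_le_gradient L0 aL.
have aL2 := max_stepsize_le_momentum L0 b0 b1 (ltW a0) aL.
have g0 : 0 < 1 - b by lra.
have gap0 y : 0 <= f y - f xs by rewrite subr_ge0.
have avg := convex_average N (hb f a b x0) mu0 fmu.
have := hb_potential x0 N L0 mu0 fL fmu fxs b0 b1 a0 aL1.
rewrite sumrB big_const_nat iter_addr_0 subn0 -[f xs *+ _]mulr_natl.
rewrite -[_ *: _]/(ahb f a b N x0 (x0 - a *: grad f x0)) in avg.
set D := dotr (x0 - xs) (x0 - xs).
set P := dotr (hb_extrapolation _ _ _ _ _ - _) _.
have P0 : 0 <= P by exact: dotr_ge0.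
have m0 : 0 <= 2 * (a / (1 - b)) * (b / (1 - b)).
  by rewrite !mulr_ge0 ?invr_ge0 //; lra.
(* The initial momentum term costs at most half of the squared distance. *)
have start : 2 * (a / (1 - b)) * (b / (1 - b)) * (f x0 - f xs) <= 2^-1 * D.
  apply: (le_trans (ler_wpM2l m0 (gap_le_dist x0 L0 mu0 fL fmu fxs))).
  rewrite -/D (mulrA _ L) ler_wpM2r ?dotr_ge0 //.
  have -> : 2 * (a / (1 - b)) * (b / (1 - b)) * L
      = 2^-1 * (a * b * (4 * L) / (1 - b) ^+ 2) by field; lra.
  by rewrite ler_piMr ?invr_ge0 // ler_pdivrMr ?exprn_gt0 // mul1r.
have last0 := mulr_ge0 m0 (gap0 (hb f a b x0 N)).
set S := \sum_(0 <= i < N.+1) _ in avg *.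
set xN := ahb _ _ _ _ _ _ in avg *.
move=> pot.
have {pot last0 start P0} pot : a / (1 - b) * (S - N.+1%:R * f xs) <= 3 / 2 * D.
  by lra.
rewrite -ler_pdivrMl //.
rewrite (_ : _^-1 * _ = a / (1 - b) * (N.+1%:R * (f xN - f xs))); last by ring.
apply: le_trans pot; rewrite ler_pM2l ?divr_gt0 //.
by rewrite mulrBr lerB.
Qed.

(** [ahb_gap] gives 3 / 32 instead of 1 / 4; the factor 4 is what makes the
    squared distance halve under [dist_le_gap]. *)
Lemma restart_gap (R : realType) n L mu (f : 'rV[R]_n -> R) xs x0 a b N :
  0 < L -> 0 < mu -> smooth L f -> strongly_convex mu f -> minimizer f xs ->
  0 <= b -> b < 1 -> 0 < a -> a <= max_stepsize L b ->
  16 * (1 - b) / (a * mu) <= N%:R ->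
  4 * (f (ahb f a b N x0 (x0 - a *: grad f x0)) - f xs)
    <= mu * dotr (x0 - xs) (x0 - xs).
Proof.
move=> L0 mu0 fL fmu fxs b0 b1 a0 aL.
rewrite ler_pdivrMr ?mulr_gt0 // => hN.
have := ahb_gap x0 N L0 mu0 fL fmu fxs b0 b1 a0 aL.
set gap := f _ - f xs; set D := dotr _ _ => /(ler_wpM2l (ltW mu0)) bound.
have gap0 : 0 <= gap by rewrite subr_ge0.
have g0 : 0 < 1 - b by lra.
have hN1 : 16 * (1 - b) <= mu * (a * N.+1%:R).
  have am0 : 0 < a * mu by rewrite mulr_gt0.
  by rewrite -natr1; lra.
have := ler_wpM2r gap0 hN1; rewrite -(mulrA mu) => /le_trans /(_ bound).
have -> : 16 * (1 - b) * gap = (1 - b) * (16 * gap) by ring.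
rewrite (mulrCA mu) ler_pM2l // => h.
have D0 : 0 <= mu * D by rewrite mulr_ge0 ?dotr_ge0 // ltW.
by lra.
Qed.

(** By [dist_le_gap] the bound of [restart_gap] for the next restart is at most
    twice the current gap, so the gap halves at each restart. *)
Lemma rahb_gap (R : realType) n L mu (f : 'rV[R]_n -> R) xs x0 a b N t :
  0 < L -> 0 < mu -> smooth L f -> strongly_convex mu f -> minimizer f xs ->
  0 <= b -> b < 1 -> 0 < a -> a <= max_stepsize L b ->
  16 * (1 - b) / (a * mu) <= N%:R ->
  2 ^+ t.+2 * (f (rahb f (fun=> a) (fun=> b) (fun=> N) x0 t.+1) - f xs)
    <= mu * dotr (x0 - xs) (x0 - xs).
Proof.
move=> L0 mu0 fL fmu fxs b0 b1 a0 aL hN.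
elim: t => [|t IH].
  have := restart_gap x0 L0 mu0 fL fmu fxs b0 b1 a0 aL hN.
  by rewrite (_ : 4 = 2 ^+ 2) //; ring.
apply: le_trans IH; set y := rahb _ _ _ _ _ t.+1.
have := restart_gap y L0 mu0 fL fmu fxs b0 b1 a0 aL hN.
rewrite -[ahb _ _ _ _ _ _]/(rahb f (fun=> a) (fun=> b) (fun=> N) x0 t.+2).
move=> /le_trans /(_ (dist_le_gap y L0 mu0 fL fmu fxs)) h.
by rewrite exprSr -mulrA ler_wpM2l ?exprn_ge0 //; lra.
Qed.

(** * Number of restarts and total cost *)

Lemma tau_ge_log2 (R : realType) (T : R) (tau : nat) :
  0 < T -> tau%:Z = Num.max (Num.ceil (log2 T) - 1) 1 -> T <= 2 ^+ tau.+1.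
Proof.
move=> T0 tauE.
have ln2 : 0 < ln 2 :> R by rewrite ln_gt0 // ltr1n.
have : Num.ceil (log2 T) <= tau.+1%:Z.
  by rewrite -addn1 PoszD -lerBlDr tauE le_max lexx.
rewrite ceil_le_int /log2 ler_pdivrMr // -pmulrn mulr_natl.
by rewrite -lnXn // ler_ln ?posrE // exprn_gt0.
Qed.

Lemma tau_le_ln (R : realType) (K T : R) (tau : nat) :
  1 < K -> K <= T -> tau%:Z = Num.max (Num.ceil (log2 T) - 1) 1 ->
  tau%:R <= ((ln 2)^-1 + (ln K)^-1) * ln T.
Proof.
move=> K1 KT tauE.
have ln2 : 0 < ln 2 :> R by rewrite ln_gt0 // ltr1n.
have lnK : 0 < ln K by rewrite ln_gt0.
have lnT : ln K <= ln T by rewrite ler_ln // posrE; lra.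
have lnT0 : 0 <= ln T by lra.
have -> : tau%:R = (tau%:Z)%:~R :> R by [].
rewrite tauE mulrDl /Num.max; case: ifP => _.
  rewrite -[leLHS]add0r lerD ?mulr_ge0 ?invr_ge0 ?(ltW ln2) ?(ltW lnK) //.
  by rewrite mulrC ler_pdivlMr // mul1r.
rewrite -[leLHS]addr0 lerD ?mulr_ge0 ?invr_ge0 ?(ltW ln2) ?(ltW lnK) //.
by rewrite mulrC ltW // ceilB1_lt.
Qed.

(** Strong convexity used in both directions bounds <g u - g 0, u> below by
    mu |u|^2 while smoothness bounds it above by L |u|^2; a nonzero u requires
    positive dimension. *)
Lemma smooth_ge_strongly_convex (R : realType) n L mu (f : 'rV[R]_n -> R) :
  (0 < n)%N -> 0 < L -> smooth L f -> strongly_convex mu f -> mu <= L.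
Proof.
case: n f => // n f _ L0 fL fmu; pose u : 'rV[R]_n.+1 := delta_mx 0 0.
have uu : dotr (u - 0) (u - 0) = 1.
  rewrite subr0 /dotr (bigD1 0) //= big1 => [|i /negPf ine0].
    by rewrite !mxE !eqxx mulr1 addr0.
  by rewrite !mxE ine0 mul0r.
have uu' : dotr (0 - u) (0 - u) = 1 by rewrite -uu !dotrE; ring.
have := smooth_dotr 0 u L0 fL; have := strongly_convexP 0 u fmu.
have := strongly_convexP u 0 fmu; rewrite uu uu' -(opprB u 0) dotrNr.
by rewrite (dotrDl (grad f u)) (dotrNl (grad f 0)); lra.
Qed.

Theorem theorem3p6 (R : realType) :
  (forall (n : nat) (f : 'rV[R]_n -> R) (L mu : R) (xs x0 : 'rV[R]_n)
      (R0 eps alpha beta : R) (N tau : nat),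
    0 < L -> 0 < mu ->
    smooth L f -> strongly_convex mu f -> minimizer f xs ->
    0 < R0 -> norm2 (x0 - xs) <= R0 -> 0 < eps ->
    0 <= beta -> beta < 1 ->
    0 < alpha -> alpha <= max_stepsize L beta ->
    N%:Z = Num.ceil (16 * (1 - beta) / (alpha * mu)) ->
    tau%:Z = Num.max (Num.ceil (log2 (mu * R0 ^+ 2 / eps)) - 1) 1 ->
    f (rahb f (fun=> alpha) (fun=> beta) (fun=> N) x0 tau) - f xs <= eps)
  /\
  (* The O(.) bound: its constant depends on no datum of the problem; it is
     uniform as long as the logarithm is bounded away from 0. *)
  (forall K : R, 1 < K ->
   exists C : R, 0 < C /\
   forall (n : nat) (f : 'rV[R]_n -> R) (L mu : R) (xs x0 : 'rV[R]_n)
      (R0 eps alpha beta : R) (N tau : nat),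
    (0 < n)%N ->
    0 < L -> 0 < mu ->
    smooth L f -> strongly_convex mu f -> minimizer f xs ->
    0 < R0 -> norm2 (x0 - xs) <= R0 -> 0 < eps ->
    0 <= beta -> beta < 1 ->
    alpha = max_stepsize L beta ->
    N%:Z = Num.ceil (16 * (1 - beta) / (alpha * mu)) ->
    tau%:Z = Num.max (Num.ceil (log2 (mu * R0 ^+ 2 / eps)) - 1) 1 ->
    K <= mu * R0 ^+ 2 / eps ->
    (N * tau)%:R <= C * ((L / mu + L * Num.sqrt beta / (mu * (1 - beta)))
                         * ln (mu * R0 ^+ 2 / eps))).
Proof.
split.
  move=> n f L mu xs x0 R0 eps a b N tau L0 mu0 fL fmu fxs R00 x0R eps0 b0 b1.
  move=> a0 aL NE tauE.
  have T0 : 0 < mu * R0 ^+ 2 / eps by rewrite divr_gt0 ?mulr_gt0 ?exprn_gt0.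
  have hN : 16 * (1 - b) / (a * mu) <= N%:R.
    by rewrite -[N%:R]/(N%:Z%:~R) NE ceil_ge.
  have hT := tau_ge_log2 T0 tauE.
  have : 1 <= tau%:Z by rewrite tauE le_max lexx orbT.
  case: tau hT {tauE} => // t hT _.
  have := rahb_gap x0 t L0 mu0 fL fmu fxs b0 b1 a0 aL hN.
  move=> /le_trans h; rewrite -(ler_pM2l (exprn_gt0 t.+2 (ltr0n R 2))).
  apply: h.
  apply: (@le_trans _ _ (mu * R0 ^+ 2)); last by rewrite -ler_pdivrMr.
  rewrite ler_wpM2l ?(ltW mu0) // -norm2_sqr lerXn2r // ?nnegrE ?sqrtr_ge0 //.
  exact: ltW.
move=> K K1.
have ln2 : 0 < ln 2 :> R by rewrite ln_gt0 // ltr1n.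
have lnK : 0 < ln K by rewrite ln_gt0.
(* 128 from the bound on 16 (1 - b) / (a mu), and 1 for rounding N up. *)
exists (129 * ((ln 2)^-1 + (ln K)^-1)); split.
  by rewrite mulr_gt0 // addr_gt0 // invr_gt0.
move=> n f L mu xs x0 R0 eps a b N tau n0 L0 mu0 fL fmu fxs R00 x0R eps0 b0 b1.
move=> aE NE tauE KT.
set A := L / mu + _; set T := mu * R0 ^+ 2 / eps.
have q0 : 0 < 1 - b by lra.
have A1 : 1 <= A.
  apply: (@le_trans _ _ (L / mu)).
    by rewrite ler_pdivlMr // mul1r (smooth_ge_strongly_convex n0 L0 fL fmu).
  by rewrite lerDl divr_ge0 ?mulr_ge0 ?sqrtr_ge0 // ltW.
have hN : N%:R <= 129 * A.
  have : N%:R - 1 <= 16 * (1 - b) / (a * mu).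
    have := ceilB1_lt (16 * (1 - b) / (a * mu)).
    by rewrite -NE intrB => /ltW.
  have -> : 16 * (1 - b) / (a * mu) = 16 * (((1 - b) / a) / mu).
    by field; rewrite aE !gt_eqF ?max_stepsize_gt0.
  have := max_stepsize_ge L0 b0 b1.
  rewrite -aE -(ler_pM2r (_ : 0 < mu^-1)) ?invr_gt0 //.
  have -> : 8 * (L + L * Num.sqrt b / (1 - b)) / mu = 8 * A.
    by rewrite /A; field; lra.
  by lra.
rewrite natrM (_ : _ * (A * _) = 129 * A * (((ln 2)^-1 + (ln K)^-1) * ln T));
  last by ring.
by rewrite ler_pM // (tau_le_ln K1 KT tauE).
Qed.
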